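(* Let $m,n\ge 1$ be integers, $\Omega=\{1,\dots,m\}$, $\mathcal{X}\subseteq\mathbb{R}^n$ a set, $J:\mathbb{R}^n\times\Omega\to\mathbb{R}$ a function (the cost function), $d>0$ a constant, and $p_0\in\mathcal{P}(\Omega)$ with $p_0(i)>0$ for every $i\in\Omega$. With $\mathcal{W}$ and $\mathcal{Z}$ as defined in the context, consider the problem $$\text{(A)}\quad \min_{\boldsymbol{x}\in\mathcal{X}}\ \max_{\hat p\in\mathcal{W}}\ \sum_{i\in\Omega}\hat p(i)\,J(\boldsymbol{x},i).$$ Then: 1. The optimal minimizers $\boldsymbol{x}$ of (A) are the same as the optimal minimizers $\boldsymbol{x}$ of $$\min_{\boldsymbol{x}\in\mathcal{X}}\ \max_{\boldsymbol{z}\in\mathcal{Z}}\ \sum_{i\in\Omega}p_0(i)\,J(\boldsymbol{x},i)\,[\boldsymbol{z}]_i .$$ 2. If $p_0(i)=1/m$ for all $i\in\Omega$ and $c:=m/(1+d)$ is an integer, then the optimal minimizers $\boldsymbol{x}$ of (A) are the same as the optimal minimizers $\boldsymbol{x}$ of $$\min_{\boldsymbol{x}\in\mathcal{X}}\ \max_{(i_1,\dots,i_c)\in\mathcal{Z}_c}\ \sum_{l=1}^{c}\frac{J(\boldsymbol{x},i_l)}{c},$$ where $\mathcal{Z}_c=\{(i_1,\dots,i_c)\in\Omega^c\mid i_j\ne i_k\text{ for all } j,k\in\{1,\dots,c\}\text{ with } j\ne k\}$. Here an optimal minimizer of a problem $\min_{\boldsymbol{x}\in\mathcal{X}}F(\boldsymbol{x})$,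 with $F(\boldsymbol{x})$ the value of the inner maximum, is a point $\boldsymbol{x}^*\in\mathcal{X}$ with $F(\boldsymbol{x}^* )\le F(\boldsymbol{x})$ for all $\boldsymbol{x}\in\mathcal{X}$.
   Context: $\mathcal{P}(\Omega)=\{p:\Omega\to[0,\infty)\mid\sum_{i\in\Omega}p(i)=1\}$ is the set of probability mass functions on $\Omega$. $[\boldsymbol{z}]_i$ denotes the $i$-th component of a vector $\boldsymbol{z}$. Ambiguity set: $\mathcal{W}=\{\hat p\in\mathcal{P}(\Omega)\mid \forall i\in\Omega,\ \hat p(i)/p_0(i)\le 1+d\}$. Weighted constraint set: $\mathcal{Z}=\{\boldsymbol{z}\in[0,1]^m\mid (1+d)\sum_{i\in\Omega}p_0(i)\,[\boldsymbol{z}]_i=1\}$. *)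

(* Defs.v *)
From mathcomp Require Import all_boot all_order all_algebra.
From mathcomp Require Import boolp classical_sets reals.

Set Implicit Arguments.
Unset Strict Implicit.
Unset Printing Implicit Defensive.

Import Order.TTheory GRing.Theory Num.Theory.

Local Open Scope classical_set_scope.
Local Open Scope ring_scope.

Definition is_max (R : realType) (T : Type) (D : set T) (f : T -> R) (v : R) :
    Prop :=
  (f @` D) v /\ ubound (f @` D) v.

(* Optimal minimizers of  min_(x in X) max_(y in D) phi x y :  F is the value
   function of the inner problem, whose maxima are required to be attained. *)
Definition minmax_minimizers (R : realType) (V T : Type) (X : set V)
    (D : set T) (phi : V -> T -> R) : set V :=
  [set x | X x /\
    exists F : V -> R,
      (forall y, X y -> is_max D (phi y) (F y)) /\
      (forall y, X y -> F x <= F y)].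

Definition pmf (R : realType) (m : nat) : set ('I_m -> R) :=
  [set p | (forall i, 0 <= p i) /\ \sum_(i < m) p i = 1].
Arguments pmf : clear implicits.

Definition ambiguity_set (R : realType) (m : nat) (p0 : 'I_m -> R) (d : R) :
    set ('I_m -> R) :=
  [set p | pmf R m p /\ forall i, p i / p0 i <= 1 + d].

Definition weight_set (R : realType) (m : nat) (p0 : 'I_m -> R) (d : R) :
    set 'rV[R]_m :=
  [set z | (forall i, 0 <= z ord0 i <= 1) /\
           (1 + d) * \sum_(i < m) p0 i * z ord0 i = 1].

Definition distinct_tuples (m c : nat) : set (c.-tuple 'I_m) :=
  [set t | forall j k : 'I_c, j <> k -> tnth t j <> tnth t k].
Arguments distinct_tuples : clear implicits.

(* Main.v *)
Require Import Defs.
From mathcomp Require Import all_boot all_order all_algebra.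
From mathcomp Require Import boolp classical_sets reals.
From mathcomp Require Import ring.

Set Implicit Arguments.
Unset Strict Implicit.
Unset Printing Implicit Defensive.

Import Order.TTheory GRing.Theory Num.Theory.

Local Open Scope classical_set_scope.
Local Open Scope ring_scope.

(** For part 1, substitute p(i) = (1 + d) p0(i) z(i), which maps the weight set
    onto the ambiguity set and multiplies the objective by 1 + d. For part 2,
    the uniform distribution on c distinct indices lies in the ambiguity set,
    and every p in it satisfies p(i) <= 1/c, so its expected cost is at most
    the mean of the c largest costs. *)

(** Every [k * g y] is a value of [f], and every value of [f] lies below some [k * g y], so the two
    maxima correspond. Mere domination in the second direction matters: a general [p] has no index
    tuple of equal cost. *)
Lemma is_max_scale (R : realType) (S T : Type) (D : set S) (E : set T)
    (f : S -> R) (g : T -> R) (k v : R) :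
  0 < k ->
  (forall y, E y -> exists2 x, D x & f x = k * g y) ->
  (forall x, D x -> exists2 y, E y & f x <= k * g y) ->
  is_max D f (k * v) <-> is_max E g v.
Proof.
move=> k_gt0 ED DE; split=> -[[a Da fa] ub].
  have gv y : E y -> g y <= v.
    move=> /ED[x Dx fx]; rewrite -(ler_pM2l k_gt0) -fx.
    by apply: ub; exists x.
  split=> [|_ [y Ey <-]]; last exact: gv.
  (* The point of [E] dominating a maximizer of [f] has value at least [v], hence exactly [v] by
     [gv]. *)
  have [y Ey] := DE _ Da; rewrite fa ler_pM2l// => vg.
  by exists y => //; apply/le_anti; rewrite vg gv.
split.
  by have [x Dx fx] := ED _ Da; exists x => //; rewrite fx fa.
move=> _ [x Dx <-]; have [y Ey /le_trans] := DE _ Dx; apply.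
by rewrite ler_pM2l//; apply: ub; exists y.
Qed.

(** The value functions differ by the positive factor [k], which is the same for every [x], so
    comparisons between them are preserved. *)
Lemma minmax_minimizers_scale (R : realType) (V S T : Type) (X : set V)
    (D : set S) (E : set T) (phi : V -> S -> R) (psi : V -> T -> R) (k : R) :
  0 < k ->
  (forall x z, E z -> exists2 y, D y & phi x y = k * psi x z) ->
  (forall x y, D y -> exists2 z, E z & phi x y <= k * psi x z) ->
  minmax_minimizers X D phi = minmax_minimizers X E psi.
Proof.
move=> k_gt0 ED DE.
have maxE x v : is_max D (phi x) (k * v) <-> is_max E (psi x) v.
  by apply: is_max_scale => //; [exact: ED | exact: DE].
apply/seteqP; split=> x [Xx [F [maxF minF]]]; split=> //.
  exists (fun y => k^-1 * F y); split=> y Xy.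
    by apply/maxE; rewrite mulVKf ?gt_eqF//; exact: maxF.
  by rewrite ler_pM2l ?invr_gt0//; exact: minF.
exists (fun y => k * F y); split=> y Xy; first by apply/maxE; exact: maxF.
by rewrite ler_pM2l//; exact: minF.
Qed.

(** Greedy construction: a set of [c] largest values grows by a maximizer of [f] on its
    complement. *)
Lemma top_set (R : realType) (T : finType) (f : T -> R) (c : nat) :
  (c <= #|T|)%N ->
  exists2 A : {set T}, #|A| = c &
    forall i j, i \in A -> j \notin A -> f j <= f i.
Proof.
elim: c => [_|c IHc c_lt].
  by exists finset.set0 => [|i j]; rewrite ?cards0// inE.
have [A cardA topA] := IHc (ltnW c_lt).
have /card_gt0P[j0 Aj0] : (0 < #|~: A|)%N.
  by rewrite cardsCs finset.setCK cardA subn_gt0.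
have [b Ab maxb] := @arg_maxP _ _ _ j0 [in ~: A] f Aj0.
move: Ab; rewrite !inE => Ab.
exists (b |: A) => [|i j]; first by rewrite cardsU1 Ab cardA.
rewrite !inE negb_or => /predU1P[->|Ai] /andP[_ Aj]; last exact: topA.
by apply: maxb; rewrite /= inE.
Qed.

(** Take a threshold [l] separating the values on [A] from those outside. Replacing [p i] by [q] on
    [A] and by 0 elsewhere can only increase the sum of [p i * (f i - l)], and both weightings have
    total mass [#|A| * q], so the terms in [l] cancel. *)
Lemma top_set_weighted_sum_le (R : realType) (T : finType) (f p : T -> R)
    (q : R) (A : {set T}) :
  (forall i, 0 <= p i <= q) -> \sum_i p i = #|A|%:R * q ->
  (forall i j, i \in A -> j \notin A -> f j <= f i) ->
  \sum_i p i * f i <= q * \sum_(i in A) f i.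
Proof.
move=> pq sump topA.
have [l lA lAC] :
    exists2 l, (forall i, i \in A -> l <= f i) & (forall j, j \notin A -> f j <= l).
  have [A0|[i0 Ai0]] := set_0Vmem A.
    (* With [A] empty there is no minimum over [A]; any upper bound of [f] serves as threshold. *)
    exists (\sum_i `|f i|) => [i|j _]; first by rewrite A0 inE.
    rewrite (bigD1 j)//= (le_trans (ler_norm _))// lerDl.
    exact: sumr_ge0.
  have [i Ai mini] := @arg_minP _ _ _ i0 [in A] f Ai0.
  by exists (f i) => // j; exact: topA.
have : \sum_i p i * (f i - l) <= \sum_(i in A) q * (f i - l).
  rewrite [leLHS](bigID [in A])/= -[leRHS]addr0; apply: lerD.
    apply: ler_sum => i Ai; have /andP[_ piq] := pq i.
    by rewrite ler_wpM2r// subr_ge0 lA.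
  apply: sumr_le0 => i Ai; have /andP[pi0 _] := pq i.
  by rewrite mulr_ge0_le0// subr_le0 lAC.
under eq_bigr do rewrite mulrBr.
rewrite big_split/= sumrN -mulr_suml sump -mulr_sumr sumrB sumr_const.
by rewrite -[l *+ _]mulr_natl mulrBr mulrA [q * _%:R]mulrC lerD2r.
Qed.

Lemma sum_tnth_uniq (R : realType) (T : finType) (c : nat) (t : c.-tuple T)
    (f : T -> R) :
  uniq t -> \sum_(l < c) f (tnth t l) = \sum_(i in t) f i.
Proof. by move=> t_uniq; rewrite -big_uniq//= [RHS]big_tuple. Qed.

Lemma distinct_tuplesP (m c : nat) (t : c.-tuple 'I_m) :
  distinct_tuples m c t <-> uniq t.
Proof.
split=> [dt|/tuple_uniqP t_inj j k jk /t_inj//].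
apply/tuple_uniqP => j k jk.
by apply: contrapT => /dt.
Qed.

Theorem theorem4 (R : realType) (m n : nat) (hm : (1 <= m)%N) (hn : (1 <= n)%N)
    (X : set 'rV[R]_n) (J : 'rV[R]_n -> 'I_m -> R) (d : R) (hd : 0 < d)
    (p0 : 'I_m -> R) (hp0 : pmf R m p0) (hp0_gt0 : forall i, 0 < p0 i) :
  minmax_minimizers X (ambiguity_set p0 d)
      (fun x p => \sum_(i < m) p i * J x i)
  = minmax_minimizers X (weight_set p0 d)
      (fun x z => \sum_(i < m) p0 i * J x i * z ord0 i)
  /\
  (forall c : nat,
     (forall i, p0 i = 1 / m%:R) ->
     c%:R = m%:R / (1 + d) ->
     minmax_minimizers X (ambiguity_set p0 d)
         (fun x p => \sum_(i < m) p i * J x i)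
     = minmax_minimizers X (distinct_tuples m c)
         (fun x t => \sum_(l < c) J x (tnth t l) / c%:R)).
Proof.
have k_gt0 : 0 < 1 + d by rewrite addr_gt0.
have k_neq0 : 1 + d != 0 by rewrite gt_eqF.
have p0_neq0 i : p0 i != 0 by rewrite gt_eqF.
split=> [|c p0E cE].
  apply: (minmax_minimizers_scale X k_gt0) => x.
    move=> z [z01 sumz]; exists (fun i => (1 + d) * (p0 i * z ord0 i)).
      split; first split=> [i|]; last 2 first.
      - by rewrite -mulr_sumr.
      - move=> i; have /andP[_ z1] := z01 i.
        by rewrite mulrCA mulrAC divff// mul1r ler_piMr// ltW.
      have /andP[z0 _] := z01 i.
      by rewrite !mulr_ge0// ltW.
    by rewrite mulr_sumr; apply: eq_bigr => i _; ring.
  move=> p [[p_ge0 sump] p_le].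
  exists (\row_i (p i / p0 i / (1 + d))).
    split=> [i|]; first rewrite mxE.
      by rewrite ler_pdivrMr// mul1r p_le !divr_ge0 ?p_ge0 ?(ltW k_gt0)// ltW.
    rewrite -[RHS]sump mulr_sumr; apply: eq_bigr => i _.
    by rewrite mxE; field; rewrite k_neq0 p0_neq0.
  (* The substitution is invertible, so equality holds here. *)
  rewrite mulr_sumr le_eqVlt; apply/orP; left; apply/eqP.
  by apply: eq_bigr => i _; rewrite mxE; field; rewrite k_neq0 p0_neq0.
have m_gt0 : 0 < m%:R :> R by rewrite ltr0n.
have c_gt0 : 0 < c%:R :> R by rewrite cE divr_gt0.
have c_neq0 : c%:R != 0 :> R by rewrite gt_eqF.
(* This turns the ratio bound of the ambiguity set into [p i <= 1/c]. *)
have p0k i : (1 + d) * p0 i = c%:R^-1.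
  by rewrite p0E cE; field; rewrite k_neq0 gt_eqF.
have c_le_m : (c <= #|'I_m|)%N.
  by rewrite card_ord -(ler_nat R) cE ler_pdivrMr// ler_peMr ?ltW// ltrDl.
(* The factor is 1: the division by [c] is already in the tuple objective. *)
apply: (minmax_minimizers_scale X ltr01) => x.
  move=> t /distinct_tuplesP t_uniq.
  exists (fun i => if i \in t then c%:R^-1 else 0).
    split; first split=> [i|].
    - by case: ifP => // _; rewrite invr_ge0 ltW.
    - rewrite -big_mkcond/= sumr_const (card_uniqP t_uniq) size_tuple.
      by rewrite -[LHS]mulr_natl divff.
    move=> i; rewrite ler_pdivrMr// p0k.
    by case: ifP => // _; rewrite invr_ge0 ltW.
  rewrite mul1r (sum_tnth_uniq (fun i => J x i / c%:R) t_uniq) [RHS]big_mkcond.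
  by apply: eq_bigr => i _; case: ifP => _; rewrite ?mul0r// mulrC.
move=> p [[p_ge0 sump] p_le].
have [A cardA topA] := top_set (J x) c_le_m.
have sizeA : size (enum A) == c by rewrite -cardE cardA.
exists (Tuple sizeA); first by apply/distinct_tuplesP; exact: enum_uniq.
rewrite mul1r (sum_tnth_uniq (fun i => J x i / c%:R)) ?enum_uniq//.
rewrite -mulr_suml mulrC.
rewrite (eq_bigl _ _ (mem_enum A)).
(* Here [q] is [1/c], so the mass condition reads [1 = c * (1/c)]. *)
apply: top_set_weighted_sum_le => // [i|].
  by rewrite p_ge0 -(p0k i) -ler_pdivrMr ?p_le.
by rewrite sump cardA divff.
Qed.
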